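(* Let $S^1\times_c\mathrm{Diff}^+(S^1)$ be the Virasoro-Bott group with Lie algebra $\mathbb R\times_\omega\mathfrak X(S^1)$ and the right invariant weak Riemannian metric induced by the inner product $\left\langle\binom ha,\binom kb\right\rangle=\int_{S^1}hk\,dx+ab$. Then, in right trivialization, the Riemannian curvature is given for $\binom{h_i}{a_i}\in\mathbb R\times_\omega\mathfrak X(S^1)$, $i=1,2,3$, by $$4\mathcal R\left(\binom{h_1}{a_1},\binom{h_2}{a_2}\right)\binom{h_3}{a_3}=\binom{H}{A},$$ where $$\begin{aligned}H=\;&4(h_1h_2''-h_1''h_2)h_3+2(a_1h_2^{(4)}-a_2h_1^{(4)})h_3\\&+\big(8(h_1h_2'-h_1'h_2)+10(a_1h_2'''-a_2h_1''')\big)h_3'\\&+18(a_1h_2''-a_2h_1'')h_3''+12(a_1h_2'-a_2h_1')h_3'''\\&+2h_3'''\int_{S^1}h_1'h_2''\,dx-h_1'''\int_{S^1}h_2'h_3''\,dx+h_2'''\int_{S^1}h_1'h_3''\,dx\\&+2a_3(h_1'''h_2'-h_1'h_2''')+2a_3(h_1h_2^{(4)}-h_1^{(4)}h_2)+a_3(a_1h_2^{(6)}-a_2h_1^{(6)}),\end{aligned}$$ $$A=\int_{S^1}h_3'''(a_1h_2'''-a_2h_1''')\,dx+\int_{S^1}2h_3'(h_1h_2'''-h_1'''h_2-2h_1'h_2''+2h_1''h_2')\,dx .$$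
   Context: Vector fields $h\partial_x$ on $S^1$ are identified with functions $h$. The Virasoro-Bott group is the central extension $S^1\times\mathrm{Diff}^+(S^1)$ with product $\binom\varphi\alpha\binom\psi\beta=\binom{\varphi\circ\psi}{\alpha\beta e^{2\pi ic(\varphi,\psi)}}$, where $c(\varphi,\psi)=\int_{S^1}\log(\varphi'\circ\psi)\,d\log\psi'$ is the Bott cocycle. Its Lie algebra is $\mathbb R\times_\omega\mathfrak X(S^1)$, with elements $\binom ha$, $h\in\mathfrak X(S^1)$, $a\in\mathbb R$, and bracket $$\left[\binom ha,\binom kb\right]=\binom{h'k-hk'}{\omega(h,k)},\qquad \omega(h,k)=\int_{S^1}h'k''\,dx$$ (the Lie algebra of the central circle being identified with $\mathbb R$ with the normalization for which the bracket has this form). The right invariant metric is obtained by right translating the inner product; right trivialization identifies each tangent space with the Lie algebra by right translation. $\mathcal R(X,Y)=[\nabla_X,\nabla_Y]-\nabla_{[X,Y]}$ is the curvature of the Levi-Civita connection $\nabla$; with $\mathrm{ad}(X)Y=[X,Y]$, $\mathrm{ad}(X)^\top$ the adjoint and $\alpha(X)Z=\mathrm{ad}(Z)^\top X$, it equals, for Lie algebra elements $X,Y$ (operator brackets being commutators), $-\tfrac14[\mathrm{ad}(X)^\top+\mathrm{ad}(X),\mathrm{ad}(Y)^\top+\mathrm{ad}(Y)]+\tfrac14[\mathrm{ad}(X)^\top-\mathrm{ad}(X),\alpha(Y)]+\tfrac14[\alpha(X),\mathrm{ad}(Y)^\top-\mathrm{ad}(Y)]+\tfrac14[\alpha(X),\alpha(Y)]+\tfrac12\alpha([X,Y])$.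 *)

(* Defs.v *)
From Stdlib Require Import Reals Lra Lia.
From Coquelicot Require Import Coquelicot.

Set Implicit Arguments.
Unset Strict Implicit.
Unset Printing Implicit Defensive.

Open Scope R_scope.

Notation "h ^( n )" := (Derive_n h n) (at level 1, format "h ^( n )") : R_scope.

Definition smooth (f : R -> R) : Prop := forall n x, ex_derive_n f n x.

Lemma smooth_of_derive (f : R -> R) n x : (forall y, ex_derive f y) ->
  ex_derive_n (Derive f) n x -> ex_derive_n f (S n) x.
Proof.
intros df d. destruct n as [|n]; [exact (df x)|].
apply (ex_derive_ext (Derive_n (Derive f) n)); [|exact d].
intro t. rewrite <- (Nat.add_1_r n). exact (Derive_n_comp f n 1 t).
Qed.

Lemma smooth_derive (f : R -> R) : smooth f -> smooth (Derive f).
Proof.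
intros sf [|n] x; [exact I|].
apply (ex_derive_ext (Derive_n f (S n))); [|exact (sf (S (S n)) x)].
intro t. rewrite <- (Nat.add_1_r n). symmetry. exact (Derive_n_comp f n 1 t).
Qed.

Lemma smooth_plus (f g : R -> R) : smooth f -> smooth g ->
  smooth (fun x => f x + g x).
Proof.
intros sf sg n x; apply ex_derive_n_plus; exists (mkposreal _ Rlt_0_1);
  intros; [apply sf|apply sg].
Qed.

Lemma smooth_scal (a : R) (f : R -> R) : smooth f -> smooth (fun x => a * f x).
Proof. intros sf n x; apply ex_derive_n_scal_l, sf. Qed.

Lemma smooth_mult (f g : R -> R) : smooth f -> smooth g ->
  smooth (fun x => f x * g x).
Proof.
intros sf sg n.
assert (H : forall k, (k <= n)%nat -> forall f g, smooth f -> smooth g ->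
  forall x, ex_derive_n (fun x => f x * g x) k x).
2: intro x; apply (H n); auto.
clear; induction n as [|n IH]; intros k Hk f g sf sg x.
{ replace k with 0%nat by lia. exact I. }
destruct k as [|k]; [exact I|].
assert (df : forall y, ex_derive f y) by (intro y; exact (sf 1%nat y)).
assert (dg : forall y, ex_derive g y) by (intro y; exact (sg 1%nat y)).
apply smooth_of_derive.
{ intro y; apply (ex_derive_mult f g); auto. }
apply (ex_derive_n_ext (fun x => Derive f x * g x + f x * Derive g x)).
{ intro t; symmetry; apply Derive_mult; auto. }
apply ex_derive_n_plus; exists (mkposreal _ Rlt_0_1); intros y _ j Hj;
  apply IH; auto using smooth_derive; lia.
Qed.

(* The circle is R / L Z, of arbitrary circumference L (in particular L = 1 or
   L = 2 * PI), and the vector field h d/dx is the L-periodic function h. *)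
Record vfield (L : R) := Vfield {
  vf_fun :> R -> R;
  vf_smooth : smooth vf_fun;
  vf_periodic : forall x, vf_fun (x + L) = vf_fun x
}.

Section VectorFields.
Variable L : R.
Implicit Types h k : vfield L.

Lemma vf_add_periodic h k x : h (x + L) + k (x + L) = h x + k x.
Proof. now rewrite !vf_periodic. Qed.

Definition vf_add h k : vfield L :=
  Vfield (smooth_plus (vf_smooth h) (vf_smooth k)) (vf_add_periodic h k).

Lemma vf_scal_periodic (a : R) h x : a * h (x + L) = a * h x.
Proof. now rewrite vf_periodic. Qed.

Definition vf_scal (a : R) h : vfield L :=
  Vfield (smooth_scal a (vf_smooth h)) (vf_scal_periodic a h).

Lemma vf_mult_periodic h k x : h (x + L) * k (x + L) = h x * k x.
Proof. now rewrite !vf_periodic. Qed.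

Definition vf_mult h k : vfield L :=
  Vfield (smooth_mult (vf_smooth h) (vf_smooth k)) (vf_mult_periodic h k).

Lemma vf_derive_periodic h x : Derive h (x + L) = Derive h x.
Proof.
transitivity (Derive (fun y => h (y + L)) x).
- symmetry. exact (Derive_n_comp_trans h 1 x L).
- apply Derive_ext, vf_periodic.
Qed.

Definition vf_derive h : vfield L :=
  Vfield (smooth_derive (vf_smooth h)) (vf_derive_periodic h).

End VectorFields.

Definition integral (L : R) (f : R -> R) : R := RInt f 0 L.

Record virasoro (L : R) := Vir { vec : vfield L; cen : R }.

Section Virasoro.
Variable L : R.
Implicit Types X Y Z : virasoro L.

Definition vir_add X Y : virasoro L :=
  Vir (vf_add (vec X) (vec Y)) (cen X + cen Y).

Definition vir_scal (a : R) X : virasoro L :=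
  Vir (vf_scal a (vec X)) (a * cen X).

Definition vir_opp X : virasoro L := vir_scal (-1) X.

Definition vir_sub X Y : virasoro L := vir_add X (vir_opp Y).

Definition omega (h k : vfield L) : R :=
  integral L (fun x => h^(1) x * k^(2) x).

(* The central component uses the normalization of the Lie algebra of the
   central circle for which the cocycle is omega; on the first component this is
   h'k - hk', the negative of the usual bracket of
   vector fields. *)
Definition bracket X Y : virasoro L :=
  let h := vec X in let k := vec Y in
  Vir (vf_add (vf_mult (vf_derive h) k) (vf_scal (-1) (vf_mult h (vf_derive k))))
      (omega h k).

Definition inner X Y : R :=
  integral L (fun x => vec X x * vec Y x) + cen X * cen Y.

(* An element X of the Lie algebra stands for the right invariant vector field
   R_X on the group that takes the value X at the identity, i.e. for the
   constant function X in right trivialization.  For a Lie algebra bracket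
   [X, Y] computed, as usual, from left invariant fields, one has
   [R_X, R_Y] = R_{-[X, Y]}, and the right invariant metric pairs R_X and R_Y
   to the constant function <X, Y>.  By the Koszul formula the Levi-Civita
   covariant derivative of a right invariant field along a right invariant one
   is again right invariant. *)

Definition field_bracket X Y : virasoro L := vir_opp (bracket X Y).

(* [metric_compatible] is d<R_Y, R_Z>(R_X) = <nabla_X Y, Z> + <Y, nabla_X Z>,
   whose left-hand side is the derivative of a constant function. *)
Record levi_civita (nabla : virasoro L -> virasoro L -> virasoro L) : Prop :=
  LeviCivita {
  nabla_add_l : forall X Y Z,
    nabla (vir_add X Y) Z = vir_add (nabla X Z) (nabla Y Z);
  nabla_scal_l : forall (a : R) X Z,
    nabla (vir_scal a X) Z = vir_scal a (nabla X Z);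
  nabla_add_r : forall X Y Z,
    nabla X (vir_add Y Z) = vir_add (nabla X Y) (nabla X Z);
  nabla_scal_r : forall X (a : R) Z,
    nabla X (vir_scal a Z) = vir_scal a (nabla X Z);
  torsion_free : forall X Y,
    vir_sub (nabla X Y) (nabla Y X) = field_bracket X Y;
  metric_compatible : forall X Y Z,
    0 = inner (nabla X Y) Z + inner Y (nabla X Z)
}.

(* Since [field_bracket X Y] is - [X, Y], the last term of the curvature is
   + nabla_{[X, Y]} Z in terms of the Lie algebra bracket. *)
Definition curvature (nabla : virasoro L -> virasoro L -> virasoro L) X Y Z :
    virasoro L :=
  vir_sub (vir_sub (nabla X (nabla Y Z)) (nabla Y (nabla X Z)))
          (nabla (field_bracket X Y) Z).

End Virasoro.

(* Main.v *)
Require Import Defs.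
From Stdlib Require Import Reals.
From Coquelicot Require Import Coquelicot.
From Stdlib Require Import Lra ProofIrrelevance FunctionalExtensionality.
Open Scope R_scope.

(** Everything is forced by one formula.  In right trivialization the
    Levi-Civita connection of the metric is
    [nabla_(h,a) (k,b) =
       (2 h k' + h' k + (a k''' + b h''') / 2, - omega(h,k) / 2)].
    The Koszul formula produces it: adding up
    [- ad(X) Y + ad(Y)^T X + ad(X)^T Y], where integration by parts gives
    [ad(h,a)^T (l,c) = (2 h' l + h l' + c h''', 0)], yields twice the right-hand
    side.  Conversely [lc_levi_civita] checks that this formula
    is torsion free and metric: both conditions reduce to the
    vanishing of integrals of exact derivatives of periodic functions.

    A weak metric may fail to have a Levi-Civita connection, but it never has
    two ([levi_civita_unique]): the difference of two such connections pairs
    with the metric to a trilinear form that is symmetric in two slots and skew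
    in two slots, hence zero, and the metric is nondegenerate because a
    continuous function with vanishing L^2 norm is zero ([square_integral_0]).
    So an arbitrary Levi-Civita connection may be replaced by the formula, and
    the curvature becomes a computation with derivatives.  Its vector part
    agrees with the claimed expression pointwise ([lc_curvature_vec]).  Its
    central part agrees only after integration: the two integrands differ by
    the derivative of an explicit periodic function ([lc_curvature_cen]). *)

(** * Derivatives of vector fields *)

Declare Scope vf_scope.
Delimit Scope vf_scope with vf.
Bind Scope vf_scope with vfield.
Infix "+" := (@vf_add _) : vf_scope.
Infix "*" := (@vf_mult _) : vf_scope.
Notation "a *: h" := (vf_scal a h) (at level 40) : vf_scope.
Notation "h - k" := (vf_add h (vf_scal (-1) k)) : vf_scope.

Section Circle.
Variable L : R.
Implicit Types f g h k l p : vfield L.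
Implicit Types X Y Z : virasoro L.

(** The composite is again a vector field, so that derivatives can be used
    inside products and primitives. *)
Fixpoint vf_derive_n h (n : nat) : vfield L :=
  match n with O => h | S n => vf_derive (vf_derive_n h n) end.

Lemma vf_ext h k : (forall x, h x = k x) -> h = k.
Proof.
destruct h as [h sh ph], k as [k sk pk]; simpl; intro E.
assert (E' : h = k) by (apply functional_extensionality, E); subst k.
now rewrite (proof_irrelevance _ sh sk), (proof_irrelevance _ ph pk).
Qed.

Lemma vir_ext X Y :
  (forall x, vec X x = vec Y x) -> cen X = cen Y -> X = Y.
Proof.
destruct X as [h a], Y as [k b]; simpl; intros Ev Ec.
now rewrite (vf_ext _ _ Ev), Ec.
Qed.

Lemma vf_ex_derive h x : ex_derive h x.
Proof. exact (vf_smooth h 1%nat x). Qed.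

Lemma vf_continuous h x : continuous h x.
Proof. apply (ex_derive_continuous h), vf_ex_derive. Qed.

Lemma vf_addE h k x : (h + k)%vf x = h x + k x.
Proof. reflexivity. Qed.

Lemma vf_scalE a h x : (a *: h)%vf x = a * h x.
Proof. reflexivity. Qed.

Lemma vf_multE h k x : (h * k)%vf x = h x * k x.
Proof. reflexivity. Qed.

Lemma vf_deriveE h x : vf_derive h x = h^(1) x.
Proof. reflexivity. Qed.

Lemma Derive_n_vf0 h x : h^(0) x = h x.
Proof. reflexivity. Qed.

Lemma Derive_n_vf_derive h n x : (vf_derive h)^(n) x = h^(S n) x.
Proof. rewrite <- (Nat.add_1_r n). exact (Derive_n_comp h n 1%nat x). Qed.

Lemma vf_derive_nE h n x : vf_derive_n h n x = h^(n) x.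
Proof.
revert x; induction n as [|n IH]; intro x; [reflexivity|].
apply Derive_ext, IH.
Qed.

Lemma Derive_n_vf_derive_n h m n x : (vf_derive_n h m)^(n) x = h^(m + n) x.
Proof.
revert n; induction m as [|m IH]; intro n; [reflexivity|].
simpl vf_derive_n. rewrite Derive_n_vf_derive, IH.
now rewrite <- plus_n_Sm.
Qed.

Lemma Derive_n_vf_add h k n x : (h + k)%vf^(n) x = h^(n) x + k^(n) x.
Proof.
apply (Derive_n_plus h k); exists (mkposreal _ Rlt_0_1);
  intros; apply vf_smooth.
Qed.

Lemma Derive_n_vf_scal a h n x : (a *: h)%vf^(n) x = a * h^(n) x.
Proof. apply Derive_n_scal_l. Qed.

Lemma Derive_n_vf_mult h k n x :
  (h * k)%vf^(S n) x = (vf_derive h * k)%vf^(n) x + (h * vf_derive k)%vf^(n) x.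
Proof.
rewrite <- Derive_n_vf_derive, <- Derive_n_vf_add.
apply Derive_n_ext; intro t.
apply (Derive_mult h k); apply vf_ex_derive.
Qed.

End Circle.

Arguments vf_derive_n {L} h n%_nat_scope.

(** Turns a pointwise identity between vector fields into one between
    polynomials in the derivatives [h^(n) x] of the variables. *)
Ltac jets :=
  rewrite ?vf_addE, ?vf_scalE, ?vf_multE, ?vf_deriveE, ?vf_derive_nE;
  repeat (rewrite ?Derive_n_vf_add, ?Derive_n_vf_scal, ?Derive_n_vf_mult,
            ?Derive_n_vf_derive, ?Derive_n_vf_derive_n, ?Derive_n_vf0,
            ?vf_addE, ?vf_scalE, ?vf_multE, ?vf_deriveE, ?vf_derive_nE);
  cbn [Nat.add].

(** * Integration over the circle *)

Section Integral.
Variable L : R.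
Implicit Types f g h k l p : vfield L.

Lemma vf_ex_RInt h a b : ex_RInt h a b.
Proof.
apply (ex_RInt_continuous (V := R_CompleteNormedModule)).
intros; apply vf_continuous.
Qed.

Lemma integral_add f g :
  integral L (f + g)%vf = integral L f + integral L g.
Proof.
exact (RInt_plus (V := R_CompleteNormedModule) f g 0 L
  (vf_ex_RInt f 0 L) (vf_ex_RInt g 0 L)).
Qed.

Lemma integral_scal a f : integral L (a *: f)%vf = a * integral L f.
Proof.
exact (RInt_scal (V := R_CompleteNormedModule) f 0 L a (vf_ex_RInt f 0 L)).
Qed.

Lemma integral_ext (f g : R -> R) :
  (forall x, f x = g x) -> integral L f = integral L g.
Proof. intro E; apply RInt_ext; intros; apply E. Qed.

Lemma integral_derive p : integral L (vf_derive p) = 0.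
Proof.
unfold integral.
rewrite (is_RInt_unique (V := R_CompleteNormedModule) _ 0 L (p L - p 0)).
- generalize (vf_periodic p 0); rewrite Rplus_0_l; lra.
- apply (is_RInt_derive p); intros x _.
  + apply Derive_correct, vf_ex_derive.
  + apply (vf_continuous _ (vf_derive p)).
Qed.

(** All integrations by parts below are instances: the periodic function [p]
    collects the boundary terms. *)
Lemma integral_by_parts f g p :
  (forall x, f x = g x + p^(1) x) -> integral L f = integral L g.
Proof.
intro E.
rewrite (integral_ext f (g + vf_derive p)%vf) by exact E.
rewrite integral_add, integral_derive; ring.
Qed.

Lemma integral_exact f p : (forall x, f x = p^(1) x) -> integral L f = 0.
Proof.
intro E; rewrite (integral_ext f (vf_derive p)) by exact E.
apply integral_derive.
Qed.

Lemma vf_periodic_Z h (n : Z) x : h (x + IZR n * L) = h x.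
Proof.
revert x; apply Z.bi_induction with (z := n).
- now intros ? ? ->.
- intro x; f_equal; ring.
- intro m; rewrite succ_IZR; split; intros E x.
  + rewrite <- (E x), <- (vf_periodic h (x + IZR m * L)); f_equal; ring.
  + rewrite <- (E x), <- (vf_periodic h (x + IZR m * L)); f_equal; ring.
Qed.

Lemma fundamental_domain (x : R) : 0 < L ->
  exists n : Z, 0 <= x + IZR n * L < L.
Proof.
intro L_gt0; exists (- Int_part (x / L))%Z.
destruct (base_Int_part (x / L)) as [lo hi]; rewrite opp_IZR.
assert (E : x = x / L * L) by (field; lra).
split; rewrite E at 1; nra.
Qed.

(** If [h] is nonzero at a point of the half-open period, then [h * h] is
    positive on a short interval to the right of it. *)
Lemma square_integral_0 h : 0 < L -> integral L (h * h)%vf = 0 ->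
  forall x, h x = 0.
Proof.
intros L_gt0 I0 x0.
destruct (fundamental_domain x0 L_gt0) as [n x_dom].
rewrite <- (vf_periodic_Z h n x0).
set (x := x0 + IZR n * L) in *; clearbody x; clear x0 n.
destruct (Req_dec (h x) 0) as [|hx]; [assumption|exfalso].
set (q := (h * h)%vf) in *.
assert (q_ge0 : forall y, 0 <= q y) by (intro y; apply Rle_0_sqr).
assert (near : locally x (fun y => 0 < q y)).
{ apply (vf_continuous _ q x (fun u => 0 < u)), (open_gt 0).
  apply Rsqr_pos_lt, hx. }
destruct near as [e He].
set (b := Rmin (x + e) L).
assert (b_lt : b <= x + e) by apply Rmin_l.
assert (b_le : b <= L) by apply Rmin_r.
assert (x_lt : x < b) by (apply Rmin_glb_lt; [destruct e; simpl|]; lra).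
assert (ge0 : forall u v, u <= v -> 0 <= RInt q u v).
{ intros u v uv; apply RInt_ge_0; auto using vf_ex_RInt. }
assert (gt0 : 0 < RInt q x b).
{ apply RInt_gt_0; [exact x_lt| |intros; apply vf_continuous].
  intros y Hy; apply He; apply Rabs_lt_between'; destruct e; simpl in *; lra. }
assert (split1 : RInt q 0 x + RInt q x b = RInt q 0 b)
  by (apply (RInt_Chasles (V := R_CompleteNormedModule)); apply vf_ex_RInt).
assert (split2 : RInt q 0 b + RInt q b L = RInt q 0 L)
  by (apply (RInt_Chasles (V := R_CompleteNormedModule)); apply vf_ex_RInt).
unfold integral in I0.
generalize (ge0 0 x) (ge0 b L); lra.
Qed.

End Integral.

(** * The metric and the Levi-Civita connection *)

Section LeviCivita.
Variable L : R.
Implicit Types f g h k l p : vfield L.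
Implicit Types X Y Z : virasoro L.

Lemma innerE X Y :
  inner X Y = integral L (vec X * vec Y)%vf + cen X * cen Y.
Proof. reflexivity. Qed.

Lemma omegaE h k :
  omega h k = integral L (vf_derive h * vf_derive_n k 2)%vf.
Proof. reflexivity. Qed.

Lemma omega_skew h k : omega k h = - omega h k.
Proof.
enough (omega k h + omega h k = 0) by lra.
rewrite !omegaE, <- integral_add.
apply integral_exact with (vf_derive h * vf_derive k)%vf.
intro x; jets; ring.
Qed.

Lemma omega_add_l f h k : omega (f + h)%vf k = omega f k + omega h k.
Proof.
rewrite !omegaE, <- integral_add; apply integral_ext; intro x; jets; ring.
Qed.

Lemma omega_scal_l a h k : omega (a *: h)%vf k = a * omega h k.
Proof.
rewrite !omegaE, <- integral_scal; apply integral_ext; intro x; jets; ring.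
Qed.

Lemma omega_add_r f h k : omega k (f + h)%vf = omega k f + omega k h.
Proof.
rewrite !(omega_skew _ k), omega_add_l; ring.
Qed.

Lemma omega_scal_r a h k : omega k (a *: h)%vf = a * omega k h.
Proof.
rewrite !(omega_skew _ k), omega_scal_l; ring.
Qed.

Lemma inner_sym X Y : inner X Y = inner Y X.
Proof.
rewrite !innerE, (Rmult_comm (cen X)); f_equal.
apply integral_ext; intro x; apply Rmult_comm.
Qed.

Lemma inner_sub_l X Y Z : inner (vir_sub X Y) Z = inner X Z - inner Y Z.
Proof.
rewrite !innerE; cbn [vir_sub vir_opp vir_scal vir_add vec cen].
rewrite (integral_ext L _ (vec X * vec Z + -1 *: (vec Y * vec Z))%vf).
- rewrite integral_add, integral_scal; ring.
- intro x; jets; ring.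
Qed.

Lemma inner_nondegenerate X : 0 < L -> inner X X = 0 ->
  (forall x, vec X x = 0) /\ cen X = 0.
Proof.
intros L_gt0; rewrite innerE; intro E.
assert (I_ge0 : 0 <= integral L (vec X * vec X)%vf).
{ apply RInt_ge_0; [lra|apply vf_ex_RInt|intros; apply Rle_0_sqr]. }
split; [apply square_integral_0|]; nra.
Qed.

(** The form [<(nabla1 - nabla2)_X Y, Z>] is symmetric in [X, Y] because both
    torsions vanish and skew in [Y, Z] because both connections are metric;
    alternating the two symmetries three times returns to the start with the
    opposite sign. *)
Lemma levi_civita_unique (nabla1 nabla2 : virasoro L -> virasoro L -> virasoro L) :
  0 < L -> levi_civita nabla1 -> levi_civita nabla2 ->
  forall X Y, nabla1 X Y = nabla2 X Y.
Proof.
intros L_gt0 LC1 LC2 X Y.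
set (T := fun A B C => inner (vir_sub (nabla1 A B) (nabla2 A B)) C).
assert (T_sym : forall A B C, T A B C = T B A C).
{ intros A B C; unfold T; rewrite !inner_sub_l.
  generalize (inner_sub_l (nabla1 A B) (nabla1 B A) C).
  generalize (inner_sub_l (nabla2 A B) (nabla2 B A) C).
  rewrite (torsion_free LC1), (torsion_free LC2); lra. }
assert (T_skew : forall A B C, T A B C = - T A C B).
{ intros A B C; unfold T; rewrite !inner_sub_l.
  generalize (metric_compatible LC1 A B C) (metric_compatible LC2 A B C).
  rewrite !(inner_sym B); lra. }
assert (T0 : forall A B C, T A B C = 0).
{ intros A B C.
  generalize (T_skew A B C) (T_sym A C B) (T_skew C A B) (T_sym C B A)
    (T_skew B C A) (T_sym B A C); lra. }
destruct (inner_nondegenerate _ L_gt0 (T0 X Y _)) as [Ev Ec].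
cbn [vir_sub vir_opp vir_scal vir_add vec cen] in Ev, Ec.
apply vir_ext; [intro x; generalize (Ev x); jets|]; lra.
Qed.

Definition lc X Y : virasoro L :=
  let h := vec X in let k := vec Y in
  Vir (2 *: (h * vf_derive k) + vf_derive h * k
       + / 2 *: (cen X *: vf_derive_n k 3 + cen Y *: vf_derive_n h 3))%vf
      (- / 2 * omega h k).

Lemma lc_torsion_free X Y : vir_sub (lc X Y) (lc Y X) = field_bracket X Y.
Proof.
apply vir_ext;
  cbn [lc field_bracket bracket vir_sub vir_opp vir_scal vir_add vec cen].
- intro x; jets; ring.
- rewrite (omega_skew (vec X) (vec Y)); field.
Qed.

Lemma lc_metric X Y Z : 0 = inner (lc X Y) Z + inner Y (lc X Z).
Proof.
rewrite !innerE; cbn [lc vec cen].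
destruct X as [h a], Y as [k b], Z as [l c]; cbn [vec cen].
match goal with |- 0 = (?I + _) + (?J + _) =>
  enough (E : I + J + - / 2 * c * omega h k + - / 2 * b * omega h l = 0) by lra
end.
rewrite !omegaE, <- !integral_scal, <- !integral_add.
apply integral_exact with
  (2 *: (h * (k * l))
   + (/ 2 * a) *: (vf_derive_n k 2 * l - vf_derive k * vf_derive l
                   + k * vf_derive_n l 2)
   + (/ 2 * b) *: (vf_derive_n h 2 * l - vf_derive h * vf_derive l)
   + (/ 2 * c) *: (vf_derive_n h 2 * k - vf_derive h * vf_derive k))%vf.
intro x; jets; field.
Qed.

Lemma lc_levi_civita : levi_civita lc.
Proof.
split; [intros X Y Z|intros a X Z|intros X Y Z|intros X a Z| |].
1-4: apply vir_ext; cbn [lc vir_add vir_scal vec cen];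
  [intro x; jets; ring
  |rewrite ?omega_add_l, ?omega_scal_l, ?omega_add_r, ?omega_scal_r; ring].
- exact lc_torsion_free.
- exact lc_metric.
Qed.

(** * Curvature *)

Lemma lc_curvature_vec h1 h2 h3 a1 a2 a3 x :
  vec (vir_scal 4 (curvature lc (Vir h1 a1) (Vir h2 a2) (Vir h3 a3))) x =
    4 * (h1 x * h2^(2) x - h1^(2) x * h2 x) * h3 x
    + 2 * (a1 * h2^(4) x - a2 * h1^(4) x) * h3 x
    + (8 * (h1 x * h2^(1) x - h1^(1) x * h2 x)
       + 10 * (a1 * h2^(3) x - a2 * h1^(3) x)) * h3^(1) x
    + 18 * (a1 * h2^(2) x - a2 * h1^(2) x) * h3^(2) x
    + 12 * (a1 * h2^(1) x - a2 * h1^(1) x) * h3^(3) x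
    + 2 * h3^(3) x * omega h1 h2
    - h1^(3) x * omega h2 h3
    + h2^(3) x * omega h1 h3
    + 2 * a3 * (h1^(3) x * h2^(1) x - h1^(1) x * h2^(3) x)
    + 2 * a3 * (h1 x * h2^(4) x - h1^(4) x * h2 x)
    + a3 * (a1 * h2^(6) x - a2 * h1^(6) x).
Proof.
cbn [curvature lc field_bracket bracket vir_sub vir_opp vir_scal vir_add vec cen].
jets; field.
Qed.

(** In the difference of the two integrands, moving every derivative off [h3],
    or off [h2] in the terms that contain [a3] instead of [h3], leaves zero; the
    boundary terms met on the way make up the primitive. *)
Lemma lc_curvature_cen h1 h2 h3 a1 a2 a3 :
  cen (vir_scal 4 (curvature lc (Vir h1 a1) (Vir h2 a2) (Vir h3 a3))) =
    integral L (fun x => h3^(3) x * (a1 * h2^(3) x - a2 * h1^(3) x))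
    + integral L (fun x => 2 * h3^(1) x *
        (h1 x * h2^(3) x - h1^(3) x * h2 x
         - 2 * h1^(1) x * h2^(2) x + 2 * h1^(2) x * h2^(1) x)).
Proof.
pose (D := @vf_derive_n L).
transitivity (integral L
  (D h3 3%nat * (a1 *: D h2 3%nat - a2 *: D h1 3%nat)
   + 2 *: (D h3 1%nat *
       (h1 * D h2 3%nat - D h1 3%nat * h2
        - 2 *: (D h1 1%nat * D h2 2%nat) + 2 *: (D h1 2%nat * D h2 1%nat))))%vf).
2: { rewrite integral_add; f_equal; apply integral_ext; intro x;
     unfold D; jets; ring. }
cbn [curvature lc field_bracket bracket vir_sub vir_opp vir_scal vir_add vec cen].
rewrite !omegaE.
repeat (rewrite <- integral_scal || rewrite <- integral_add).
apply integral_by_parts with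
  (2 *: ((D h1 2%nat * D h2 1%nat - D h1 1%nat * D h2 2%nat) * h3)
   + 2 *: ((D h1 2%nat * h2 - h1 * D h2 2%nat) * D h3 1%nat)
   + 4 *: ((h1 * D h2 1%nat - D h1 1%nat * h2) * D h3 2%nat)
   + a1 *: (D h2 1%nat * D h3 4%nat - D h2 2%nat * D h3 3%nat)
   - a2 *: (D h1 1%nat * D h3 4%nat - D h1 2%nat * D h3 3%nat)
   + a3 *: (D h1 4%nat * D h2 1%nat - D h1 3%nat * D h2 2%nat
            + D h1 2%nat * D h2 3%nat - D h1 1%nat * D h2 4%nat))%vf.
intro x; unfold D; jets; field.
Qed.

End LeviCivita.

Theorem mainTheorem9 (L : R) (L_gt0 : 0 < L) :
  (exists nabla : virasoro L -> virasoro L -> virasoro L, levi_civita nabla) /\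
  forall nabla : virasoro L -> virasoro L -> virasoro L, levi_civita nabla ->
  forall (h1 h2 h3 : vfield L) (a1 a2 a3 : R),
  let R4 := vir_scal 4 (curvature nabla (Vir h1 a1) (Vir h2 a2) (Vir h3 a3)) in
  (forall x : R,
    vec R4 x =
      4 * (h1 x * h2^(2) x - h1^(2) x * h2 x) * h3 x
      + 2 * (a1 * h2^(4) x - a2 * h1^(4) x) * h3 x
      + (8 * (h1 x * h2^(1) x - h1^(1) x * h2 x)
         + 10 * (a1 * h2^(3) x - a2 * h1^(3) x)) * h3^(1) x
      + 18 * (a1 * h2^(2) x - a2 * h1^(2) x) * h3^(2) x
      + 12 * (a1 * h2^(1) x - a2 * h1^(1) x) * h3^(3) x
      + 2 * h3^(3) x * integral L (fun y => h1^(1) y * h2^(2) y)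
      - h1^(3) x * integral L (fun y => h2^(1) y * h3^(2) y)
      + h2^(3) x * integral L (fun y => h1^(1) y * h3^(2) y)
      + 2 * a3 * (h1^(3) x * h2^(1) x - h1^(1) x * h2^(3) x)
      + 2 * a3 * (h1 x * h2^(4) x - h1^(4) x * h2 x)
      + a3 * (a1 * h2^(6) x - a2 * h1^(6) x)) /\
  cen R4 =
    integral L (fun x => h3^(3) x * (a1 * h2^(3) x - a2 * h1^(3) x))
    + integral L (fun x => 2 * h3^(1) x *
        (h1 x * h2^(3) x - h1^(3) x * h2 x
         - 2 * h1^(1) x * h2^(2) x + 2 * h1^(2) x * h2^(1) x)).
Proof.
split; [exists (lc L); apply lc_levi_civita|].
intros nabla LC h1 h2 h3 a1 a2 a3.
assert (E : nabla = lc L).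
{ apply functional_extensionality; intro X.
  apply functional_extensionality; intro Y.
  exact (levi_civita_unique L nabla (lc L) L_gt0 LC (lc_levi_civita L) X Y). }
subst nabla; intro R4; split.
- intro x; apply lc_curvature_vec.
- apply lc_curvature_cen.
Qed.
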